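(* If $k\ge 4$ is an even integer and $n$ is a positive integer, then $\tilde{r}(C_k,P_n)\le 2n+11k$.
   Context: The online Ramsey game is played between Builder and Painter on the infinite complete graph $K_{\mathbb N}$. In each round Builder selects a previously unselected edge of $K_{\mathbb N}$ and Painter colors it red or blue. For finite graphs $G_1,G_2$, the game ends as soon as the graph formed by all colored edges contains a red copy of $G_1$ or a blue copy of $G_2$; Builder wants to end the game as soon as possible and Painter wants to delay the end. The online Ramsey number $\tilde{r}(G_1,G_2)$ is the minimum number of rounds within which Builder can guarantee the end of the game, both players playing optimally. $C_k$ denotes the cycle on $k$ vertices and $P_n$ the path on $n$ vertices. *)

(* Defs.v *)
From mathcomp Require Import all_boot.
Set Implicit Arguments.
Unset Strict Implicit.
Unset Printing Implicit Defensive.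

Record sgraph := SGraph {
  vertex :> finType;
  adj : rel vertex;
  adj_sym : symmetric adj;
  adj_irrefl : irreflexive adj
}.

Definition path_adj n : rel 'I_n := fun i j => (j == i.+1 :> nat) || (i == j.+1 :> nat).

Lemma path_adj_sym n : symmetric (@path_adj n).
Proof. by move=> i j; rewrite /path_adj orbC. Qed.

Lemma path_adj_irrefl n : irreflexive (@path_adj n).
Proof. by move=> i; rewrite /path_adj orbb; apply/negbTE; rewrite neq_ltn ltnSn. Qed.

(* The path on [n] vertices, hence with [n.-1] edges. *)
Definition path_graph n := SGraph (@path_adj_sym n) (@path_adj_irrefl n).

(* [ordS] is the successor modulo [k]; the condition [i != j] only matters for
   [k = 1]. The result is a cycle for [2 < k]. *)
Definition cycle_adj k : rel 'I_k :=
  fun i j => (i != j) && ((j == ordS i) || (i == ordS j)).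

Lemma cycle_adj_sym k : symmetric (@cycle_adj k).
Proof. by move=> i j; rewrite /cycle_adj eq_sym orbC. Qed.

Lemma cycle_adj_irrefl k : irreflexive (@cycle_adj k).
Proof. by move=> i; rewrite /cycle_adj eqxx. Qed.

Definition cycle_graph k := SGraph (@cycle_adj_sym k) (@cycle_adj_irrefl k).

(* Copies are subgraphs, not necessarily induced ones. *)
Definition has_copy (G : sgraph) (E : rel nat) : Prop :=
  exists2 f : G -> nat, injective f & forall x y : G, adj x y -> E (f x) (f y).

(* A position of the game on the complete graph over [nat] is the pair of
   symmetric relations [red] and [blue] formed by the edges colored so far. *)
Definition no_edge : rel nat := fun _ _ => false.

Definition add_edge (u v : nat) (E : rel nat) : rel nat :=
  fun x y => [|| E x y, (x == u) && (y == v) | (x == v) && (y == u)].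

Definition game_over (G1 G2 : sgraph) (red blue : rel nat) : Prop :=
  has_copy G1 red \/ has_copy G2 blue.

(* From the position [(red, blue)], Builder can guarantee that the game ends
   within [m] more rounds: unless it is already over, she has an unselected
   edge [uv] to play such that she still can do so within [m.-1] rounds, be
   [uv] colored red or blue. *)
Fixpoint builder_wins (G1 G2 : sgraph) (m : nat) (red blue : rel nat) : Prop :=
  game_over G1 G2 red blue \/
  if m is m'.+1 then
    exists u v : nat,
      [/\ u != v, ~~ (red u v || blue u v),
          builder_wins G1 G2 m' (add_edge u v red) blue
        & builder_wins G1 G2 m' red (add_edge u v blue)]
  else False.

Definition is_online_ramsey_number (G1 G2 : sgraph) (r : nat) : Prop :=
  builder_wins G1 G2 r no_edge no_edge /\
  forall m, builder_wins G1 G2 m no_edge no_edge -> r <= m.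

(* Main.v *)
(** Builder keeps [c < k] disjoint blue paths whose heads form a red path. To
    enlarge the family she joins a fresh vertex to the first head; if the edge is
    blue, she goes on from the enlarged path to the next head, and so on. When
    [c = k.-1], a vertex joined in red to the first head is joined in blue to the
    last one, because the red edge would close a red cycle. With [V] vertices on
    these paths, this takes at most [2 * V - c] edges.
    Once [V] is [n + 2 * k - 3], the heads are cut off: they form a red path of
    free vertices, the hub. The remaining paths are merged through hub vertices.
    An end of a path which is red to the first hub vertex may itself be cut off
    and pushed on the hub. When the hub has [k.-1] vertices, no end is red to both
    of its extremities, so among three paths two can be joined through one of
    them. The last two paths are joined, up to losing few vertices, along a
    [k]-cycle which alternates between their ends: this uses that [k] is even. *)

Require Import Defs.
From mathcomp Require Import all_boot.
From mathcomp Require Import zify.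
From Stdlib Require Import Classical.

Set Implicit Arguments.
Unset Strict Implicit.
Unset Printing Implicit Defensive.

(** * Least number of rounds and monotonicity of the game *)

(** Classical reasoning is used because [builder_wins] quantifies over all vertices and comes with
    no decision procedure. *)
Lemma ex_least (P : nat -> Prop) m :
  P m -> exists2 r, P r /\ (forall i, P i -> r <= i) & r <= m.
Proof.
elim/ltn_ind: m => m IHm Pm.
have [[i Pi ltim]|min_m] := classic (exists2 i, P i & i < m).
  have [r r_min le_ri] := IHm i ltim Pi.
  by exists r => //; apply: leq_trans le_ri (ltnW ltim).
exists m => //; split=> // i Pi; rewrite leqNgt; apply/negP => ltim.
by apply: min_m; exists i.
Qed.

Lemma add_edge_sym u v (E : rel nat) : symmetric E -> symmetric (add_edge u v E).
Proof.
move=> symE x y; rewrite /add_edge symE; congr (_ || _).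
by rewrite orbC andbC [(y == v) && _]andbC.
Qed.

Lemma sub_add_edge u v (E : rel nat) : subrel E (add_edge u v E).
Proof. by move=> x y Exy; rewrite /add_edge Exy. Qed.

Lemma add_edge_mem u v (E : rel nat) : add_edge u v E u v.
Proof. by rewrite /add_edge !eqxx orbT. Qed.

Lemma add_edge_subrel u v (E E' : rel nat) :
  symmetric E' -> subrel E E' -> E' u v -> subrel (add_edge u v E) E'.
Proof.
move=> symE' sEE' E'uv x y /or3P[/sEE' //|/andP[/eqP-> /eqP->] //|].
by case/andP=> /eqP-> /eqP->; rewrite symE'.
Qed.

Lemma has_copy_subrel G (E E' : rel nat) :
  subrel E E' -> has_copy G E -> has_copy G E'.
Proof. by move=> sEE' [f injf Ef]; exists f => // x y /Ef/sEE'. Qed.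

Lemma builder_wins_over G1 G2 m (R B : rel nat) :
  game_over G1 G2 R B -> builder_wins G1 G2 m R B.
Proof. by move=> over; case: m => [|m]; left. Qed.

(** Extra colored edges never hurt Builder: if the edge that she plans is already colored, she skips
    the round and follows the branch of that color. *)
Lemma builder_wins_subrel G1 G2 m m' (R R' B B' : rel nat) :
    symmetric R' -> symmetric B' -> subrel R R' -> subrel B B' -> m <= m' ->
  builder_wins G1 G2 m R B -> builder_wins G1 G2 m' R' B'.
Proof.
elim: m m' R R' B B' => [|m IHm] m' R R' B B' symR symB sR sB le_mm'.
  case=> [[/(has_copy_subrel sR)|/(has_copy_subrel sB)] over|//].
    by apply: builder_wins_over; left.
  by apply: builder_wins_over; right.
case=> [[/(has_copy_subrel sR)|/(has_copy_subrel sB)] over|].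
- by apply: builder_wins_over; left.
- by apply: builder_wins_over; right.
case: m' le_mm' => // m' le_mm' [u [v [neq_uv _ winR winB]]].
have [R'uv|R'uv] := boolP (R' u v).
  apply: IHm winR => //; last exact: leqW.
  exact: add_edge_subrel.
have [B'uv|B'uv] := boolP (B' u v).
  apply: IHm winB => //; last exact: leqW.
  exact: add_edge_subrel.
right; exists u, v; split=> //; first by rewrite negb_or R'uv.
- apply: IHm winR => //; first exact: add_edge_sym.
  apply: add_edge_subrel (add_edge_mem _ _ _); first exact: add_edge_sym.
  by move=> x y /sR; apply: sub_add_edge.
- apply: IHm winB => //; first exact: add_edge_sym.
  apply: add_edge_subrel (add_edge_mem _ _ _); first exact: add_edge_sym.
  by move=> x y /sB; apply: sub_add_edge.
Qed.

Lemma builder_wins_leq G1 G2 m m' (R B : rel nat) :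
    symmetric R -> symmetric B -> m <= m' ->
  builder_wins G1 G2 m R B -> builder_wins G1 G2 m' R B.
Proof. by move=> symR symB; apply: builder_wins_subrel. Qed.

(* Builder may also pretend to play an edge which is already selected. *)
Lemma builder_play G1 G2 m u v (R B : rel nat) :
    symmetric R -> symmetric B -> u != v ->
    (forall R', symmetric R' -> subrel R R' -> R' u v ->
       builder_wins G1 G2 m R' B) ->
    (forall B', symmetric B' -> subrel B B' -> B' u v ->
       builder_wins G1 G2 m R B') ->
  builder_wins G1 G2 m.+1 R B.
Proof.
move=> symR symB neq_uv winR winB.
have [Ruv|Ruv] := boolP (R u v).
  by apply: builder_wins_leq (winR R _ _ _).
have [Buv|Buv] := boolP (B u v).
  by apply: builder_wins_leq (winB B _ _ _).
right; exists u, v; split=> //; first by rewrite negb_or Ruv.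
- by apply: winR; [apply: add_edge_sym|apply: sub_add_edge|apply: add_edge_mem].
- by apply: winB; [apply: add_edge_sym|apply: sub_add_edge|apply: add_edge_mem].
Qed.

(** * Blue paths and red cycles read off sequences of vertices *)

Lemma has_copy_path n (B : rel nat) s :
    symmetric B -> sorted B s -> uniq s -> n <= size s ->
  has_copy (path_graph n) B.
Proof.
move=> symB Bs uniq_s le_ns.
have lt_s (i : 'I_n) : i < size s by apply: leq_trans le_ns.
exists (fun i : 'I_n => nth 0 s i) => [i j /eqP|i j] /=.
  by rewrite nth_uniq // => /eqP/val_inj.
have step (i' j' : 'I_n) : j' = i'.+1 :> nat -> B (nth 0 s i') (nth 0 s j').
  by move=> def_j; rewrite def_j; apply: (sortedP 0) => //; rewrite -def_j.
by case/orP=> /eqP/step //; rewrite symB.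
Qed.

Lemma has_copy_cycle k (R : rel nat) (f : nat -> nat) :
    symmetric R -> {in gtn k &, injective f} ->
    (forall i, i < k -> R (f i) (f (i.+1 %% k))) ->
  has_copy (cycle_graph k) R.
Proof.
move=> symR injf Rf; exists (fun i : 'I_k => f i) => [i j /injf|i j] /=.
  by rewrite !inE !ltn_ord => /(_ isT isT)/val_inj.
by case/andP=> _ /orP[]/eqP->; last rewrite symR; apply: Rf.
Qed.

Lemma has_copy_cycle_seq (R : rel nat) s :
    symmetric R -> uniq s -> cycle R s -> has_copy (cycle_graph (size s)) R.
Proof.
move=> symR uniq_s Rs; apply: (has_copy_cycle (f := nth 0 s)) => //.
  by move=> i j lti ltj /eqP; rewrite nth_uniq // => /eqP.
case: s uniq_s Rs => // x s uniq_s /= /(pathP 0) Rs i lt_i.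
have := Rs i; rewrite size_rcons => /(_ lt_i).
rewrite -rcons_cons nth_rcons /= lt_i nth_rcons; move: lt_i; rewrite ltnS leq_eqVlt => /predU1P[->|lt_i].
  by rewrite ltnn eqxx modnn.
by rewrite lt_i modn_small.
Qed.

(* A vertex closing a red path on [k.-1] vertices at both ends. *)
Lemma has_copy_close k (R : rel nat) v s :
    symmetric R -> uniq (v :: s) -> sorted R s -> (size s).+1 = k -> s != [::] ->
    R v (head 0 s) -> R v (last 0 s) ->
  has_copy (cycle_graph k) R.
Proof.
case: s => // y s symR uniq_s Rs <- _ Rvy Rvs.
apply: (has_copy_cycle_seq symR uniq_s).
rewrite -[cycle _ _]/(path R v (rcons (y :: s) v)) rcons_path symR Rvs andbT.
by apply/andP.
Qed.

(** * Systems of disjoint blue paths *)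

(** The induction moves [p] onto [q] vertex by vertex; the guard [p != [::]] lets it end at the
    empty path. *)
Lemma sorted_join (B : rel nat) p q :
    symmetric B -> sorted B p -> sorted B q -> q != [::] ->
    (p != [::] -> B (head 0 p) (head 0 q)) ->
  sorted B (rev p ++ q).
Proof.
move=> symB; elim: p q => [|x p IHp] q Bp Bq q0 Bpq; first by rewrite cat0s.
rewrite rev_cons cat_rcons; apply: IHp => //=; first exact: path_sorted Bp.
  by case: q q0 Bq Bpq => //= y q _ -> ->.
by case: p Bp {Bpq} => //= y p /andP[]; rewrite symB.
Qed.

(** Uniqueness of the flattened list makes each path simple and the paths pairwise disjoint. *)
Definition path_system (B : rel nat) (ps : seq (seq nat)) :=
  all (fun p => (p != [::]) && sorted B p) ps && uniq (flatten ps).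

Lemma path_system_subrel (B B' : rel nat) ps :
  subrel B B' -> path_system B ps -> path_system B' ps.
Proof.
move=> sB /andP[Bps uniq_ps]; apply/andP; split=> //.
apply: sub_all Bps => p /andP[-> /=]; exact: sub_sorted.
Qed.

Definition red_headed (R B : rel nat) ps :=
  sorted R (map (head 0) ps) && path_system B ps.

Definition fresh (s : seq nat) := (\max_(x <- s) x).+1.

Lemma fresh_notin s : fresh s \notin s.
Proof.
apply/negP=> fresh_s; have := @leq_bigmax_seq _ s predT id _ fresh_s isT.
by rewrite ltnn.
Qed.

Lemma path_system_perm (B : rel nat) ps qs :
  perm_eq ps qs -> path_system B ps = path_system B qs.
Proof.
move=> eq_pq; congr (_ && _); first exact: perm_all.
by apply: perm_uniq; apply: perm_flatten.
Qed.

Lemma path_system_fresh (B : rel nat) ps :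
  path_system B ps -> path_system B ([:: fresh (flatten ps)] :: ps).
Proof. by case/andP=> Bps uniq_ps; rewrite /path_system /= Bps uniq_ps fresh_notin. Qed.

(** Paths are joined at their heads, hence the reversal; the new head is the far end of [p]. *)
Lemma path_system_join (B : rel nat) p q ps :
    symmetric B -> path_system B [:: p, q & ps] -> B (head 0 p) (head 0 q) ->
  path_system B ((rev p ++ q) :: ps).
Proof.
move=> symB /andP[/= /and3P[/andP[p0 Bp] /andP[q0 Bq] Bps] uniq_pq] Bpq.
apply/andP; split=> /=; last first.
  by rewrite -catA (perm_uniq (_ : perm_eq _ (p ++ q ++ flatten ps))) //
             perm_cat2r perm_rev.
rewrite Bps andbT sorted_join // andbT -size_eq0 size_cat.
by case: q q0 {Bq Bpq uniq_pq} => // y q _; rewrite addnS.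
Qed.

Lemma path_system_head_neq (B : rel nat) p q ps :
  path_system B [:: p, q & ps] -> head 0 p != head 0 q.
Proof.
case/andP=> /= /and3P[/andP[p0 _] /andP[q0 _] _].
case: p q p0 q0 => [|x p] [|y q] //= _ _ /andP[notin_x _].
by apply: contraNneq notin_x => ->; rewrite !(mem_cat, inE) eqxx orbT.
Qed.

Lemma heads_uniq (B : rel nat) ps :
  path_system B ps -> uniq (map (head 0) ps).
Proof.
case/andP; elim: ps => //= p ps IHps /andP[/andP[p0 _] Bps].
rewrite cat_uniq => /and3P[_ disj_p /(IHps Bps)->]; rewrite andbT.
case: p p0 disj_p => // x p _ /= disj_p; apply/mapP=> -[q ps_q def_x].
case/hasP: disj_p; exists x; last exact: mem_head.
apply/flattenP; exists q => //; rewrite def_x.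
have /andP[] := allP Bps q ps_q; case: q {ps_q def_x} => //= y q _ _.
exact: mem_head.
Qed.

(** * Growing a family of blue paths with red-linked heads *)

(* The loose blue path [p] has no red link yet with the heads of [ps]. *)
Lemma builder_attaches k n d V :
    (forall (R B : rel nat) ps, symmetric R -> symmetric B ->
       red_headed R B ps -> 0 < size ps < k -> size (flatten ps) = V ->
     builder_wins (cycle_graph k) (path_graph n) (d + size ps) R B) ->
  forall (R B : rel nat) p ps, symmetric R -> symmetric B ->
    sorted R (map (head 0) ps) -> path_system B (p :: ps) ->
    (size ps).+1 < k -> size (flatten (p :: ps)) = V ->
  builder_wins (cycle_graph k) (path_graph n) (d + (size ps).+2) R B.
Proof.
move=> winS R B p ps symR symB; elim: ps p B symB => [|q ps IHps] p B symB.
  move=> _ Bp lt_k size_V.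
  by apply: builder_wins_leq (winS R B [:: p] _ _ _ _ _); rewrite ?addn2 ?addn1.
move=> Rps Bps lt_k size_V; rewrite addnS.
apply: (builder_play symR symB (path_system_head_neq Bps)).
  move=> R' symR' sR R'pq; apply: (winS R' B [:: p, q & ps]) => //.
  apply/andP; split=> //=; rewrite R'pq; exact: sub_sorted Rps.
(* A blue edge absorbs [q]: the family loses a path, which pays for the edge. *)
move=> B' symB' sB B'pq; apply: (IHps (rev p ++ q)) => //; first exact: path_sorted Rps.
- by apply: path_system_join => //; apply: (path_system_subrel sB).
- exact: ltnW.
- by rewrite -size_V /= !size_cat size_rev addnA.
Qed.

(** Amortized count: each fresh vertex brings a credit of two edges, and the number of paths is the
    potential. A blue join lowers it by one, a red link that creates a new head raises it by one. *)
Lemma builder_grows k n N F :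
    3 < k ->
    (forall (R B : rel nat) ps, symmetric R -> symmetric B ->
       red_headed R B ps -> 0 < size ps < k -> size (flatten ps) = N ->
     builder_wins (cycle_graph k) (path_graph n) (F + size ps) R B) ->
  forall d (R B : rel nat) ps, symmetric R -> symmetric B ->
    red_headed R B ps -> 0 < size ps < k -> size (flatten ps) + d = N ->
  builder_wins (cycle_graph k) (path_graph n) (2 * d + F + size ps) R B.
Proof.
move=> k_gt3 winN; elim=> [|d IHd] R B ps symR symB.
  by rewrite addn0; apply: winN.
move=> RBps /andP[ps_gt0 lt_ps_k] size_N.
have winS R1 B1 qs : symmetric R1 -> symmetric B1 -> red_headed R1 B1 qs ->
    0 < size qs < k -> size (flatten qs) = (size (flatten ps)).+1 ->
    builder_wins (cycle_graph k) (path_graph n) (2 * d + F + size qs) R1 B1.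
  by move=> ? ? ? ? eq_size; apply: IHd => //; rewrite eq_size addSnnS.
have /andP[Rps Bps] := RBps.
have [v Bvps] : exists v, path_system B ([:: v] :: ps).
  by exists (fresh (flatten ps)); apply: path_system_fresh.
have [lt_k|ge_k] := ltnP (size ps).+1 k.
  have -> : 2 * d.+1 + F + size ps = 2 * d + F + (size ps).+2 by lia.
  exact: (builder_attaches winS symR symB Rps Bvps).
(* With [k.-1] paths there is no room for another head, so the last path is singled out too. *)
have size_ps : (size ps).+1 = k by lia.
have -> : 2 * d.+1 + F + size ps = (2 * d + F + (size ps).+1).+1 by lia.
have [p [qs [q def_ps]]] : exists p qs q, ps = p :: rcons qs q.
  case: (ps) size_ps => [|p qs] /=; first by lia.
  by case/lastP: qs => [|qs q] /=; [lia | exists p, qs, q].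
subst ps.
have eq_perm : perm_eq [:: [:: v], p & rcons qs q] [:: [:: v], q, p & qs].
  by rewrite perm_cons -rcons_cons perm_rcons.
apply: (builder_play symR symB (path_system_head_neq Bvps)).
  move=> R' symR' sR R'vp; rewrite addnS.
  have Bvqs := Bvps; rewrite (path_system_perm _ eq_perm) in Bvqs.
  apply: (builder_play symR' symB (path_system_head_neq Bvqs)).
    move=> R'' symR'' sR' R''vq; apply: builder_wins_over; left.
    apply: (has_copy_close (v := v) (s := map (head 0) (p :: rcons qs q))) => //.
    - exact: (heads_uniq Bvps).
    - by apply: sub_sorted Rps => x y /sR/sR'.
    - by rewrite size_map.
    - exact: sR'.
    - by rewrite /= map_rcons last_rcons.
  (* Now [v] leads the path of [q] and precedes the head of [p] in the red path: two edges are spent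
     and the number of paths is unchanged. *)
  move=> B' symB' sB B'vq.
  have <- : size ((rev [:: v] ++ q) :: p :: qs) = size (p :: rcons qs q).
    by rewrite /= size_rcons.
  apply: winS => //.
  - apply/andP; split; last first.
      by apply: path_system_join => //; apply: (path_system_subrel sB).
    move: Rps; rewrite /= R'vp map_rcons rcons_path => /andP[Rps _] /=.
    by apply: sub_path Rps.
  - by move: lt_ps_k; rewrite /= size_rcons.
  - by rewrite /= flatten_rcons !size_cat /=; lia.
move=> B' symB' sB B'vp.
rewrite [size (p :: _)]/=.
apply: (builder_attaches winS symR symB' (p := rev [:: v] ++ p)).
- exact: path_sorted Rps.
- by apply: path_system_join => //; apply: (path_system_subrel sB).
- by rewrite -size_ps.
- by rewrite /= size_cat.
Qed.

(** * Joining the last two paths along an even cycle *)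

(** Joining at inner vertices loses only the [i + j] vertices in front of them. *)
Lemma path_system_cut (B : rel nat) i j p q :
    symmetric B -> path_system B [:: p; q] -> i < size p -> j < size q ->
    B (nth 0 p i) (nth 0 q j) ->
  path_system B [:: rev (drop i p) ++ drop j q].
Proof.
move=> symB /andP[/= /and3P[/andP[_ Bp] /andP[_ Bq] _] uniq_pq] lt_i lt_j Bpq.
have drop_neq0 s l : l < size s -> drop l s != [::] :> seq nat.
  by move=> lt_l; rewrite -size_eq0 size_drop subn_eq0 -ltnNge.
apply: path_system_join => //; last first.
  by rewrite -!nth0 !nth_drop !addn0.
apply/andP; rewrite /= !drop_neq0 // !drop_sorted //; split=> //.
apply: subseq_uniq uniq_pq; rewrite /= !cats0.
by apply: cat_subseq; apply: drop_subseq.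
Qed.

Lemma builder_wins_long k n m (R B : rel nat) p ps :
    symmetric B -> path_system B (p :: ps) -> n <= size p ->
  builder_wins (cycle_graph k) (path_graph n) m R B.
Proof.
move=> symB /andP[/= /andP[/andP[_ Bp] _]]; rewrite cat_uniq => /andP[uniq_p _].
by move=> le_n; apply: builder_wins_over; right; apply: (has_copy_path symB Bp).
Qed.

(* Builder plays the closed walk [p_0 q_0 p_1 q_1 ...] of length [k] through the
   first [k./2] vertices of [p] and of [q]: it exists because [k] is even. A blue
   edge of it joins [p] and [q] at the cost of at most [k - 2] vertices. *)
Lemma builder_joins_two k n (R B : rel nat) p q :
    3 < k -> ~~ odd k -> symmetric R -> symmetric B -> path_system B [:: p; q] ->
    n + k <= (size p + size q).+2 ->
  builder_wins (cycle_graph k) (path_graph n) k R B.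
Proof.
move=> k_gt3 even_k symR symB Bpq le_n.
(* If one path has fewer than [k./2] vertices, the other already has at least [n]. *)
have [lt_p|le_p] := ltnP (size p) k./2.
  have eq_pq : perm_eq [:: q; p] [:: p; q].
    by rewrite (perm_catC [:: q] [:: p]).
  apply: (@builder_wins_long _ _ _ _ _ q [:: p]) => //; last by lia.
  by rewrite (path_system_perm _ eq_pq).
have [lt_q|le_q] := ltnP (size q) k./2.
  by apply: (builder_wins_long _ _ _ symB Bpq); lia.
have lt_half (s : seq nat) t : k./2 <= size s -> t < k -> t./2 < size s by lia.
pose z t := nth 0 (if odd t then q else p) t./2.
have z_inj : {in gtn k &, injective z}.
  have /andP[_ /=] := Bpq; rewrite cats0 cat_uniq => /and3P[uniq_p disj_pq uniq_q].
  have disj i j : i < size p -> j < size q -> nth 0 p i != nth 0 q j.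
    move=> lt_i lt_j; apply: contraNneq disj_pq => eq_ij; apply/hasP.
    by exists (nth 0 q j); rewrite ?mem_nth //= -eq_ij mem_nth.
  move=> t s; rewrite !inE /z => lt_t lt_s.
  case: ifPn => odd_t; case: ifPn => odd_s /eqP.
  - by rewrite nth_uniq ?lt_half //; lia.
  - by rewrite eq_sym (negPf (disj _ _ _ _)) ?lt_half.
  - by rewrite (negPf (disj _ _ _ _)) ?lt_half.
  - by rewrite nth_uniq ?lt_half //; lia.
(* Invariant: the first [t] edges of the walk are red and [j] remain; at [j = 0] they form the red
   cycle. *)
suff win j t R' : symmetric R' -> j + t = k ->
    (forall s, s < t -> R' (z s) (z (s.+1 %% k))) ->
    builder_wins (cycle_graph k) (path_graph n) j R' B.
  by apply: (win _ 0) => //; rewrite addn0.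
elim: j t R' => [|j IHj] t R' symR' def_k Rz.
  apply: builder_wins_over; left; apply: (has_copy_cycle (f := z)) => // i lt_i.
  by apply: Rz; rewrite -def_k in lt_i.
have lt_mod : t.+1 %% k < k by rewrite ltn_mod; lia.
have neq_z : z t != z (t.+1 %% k).
  apply/eqP => /z_inj; rewrite !inE lt_mod => eq_t.
  have {}eq_t : t = t.+1 %% k by apply: eq_t => //; lia.
  have [lt_t1|ge_t1] := ltnP t.+1 k; first by rewrite modn_small in eq_t; lia.
  have def_t : t.+1 = k by lia.
  by rewrite def_t modnn in eq_t; lia.
apply: (builder_play symR' symB neq_z).
  move=> R'' symR'' sR R''z; apply: (IHj t.+1) => //; first by lia.
  move=> s; rewrite ltnS leq_eqVlt => /predU1P[->|/Rz/sR] //.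
move=> B' symB' sB B'z.
have win_cut i l : i < size p -> l < size q -> (i + l).+2 <= k ->
    B' (nth 0 p i) (nth 0 q l) ->
    builder_wins (cycle_graph k) (path_graph n) j R' B'.
  move=> lt_i lt_l le_il B'il.
  have B'pq := path_system_subrel sB Bpq.
  apply: (builder_wins_long _ _ _ symB' (path_system_cut symB' B'pq lt_i lt_l B'il)).
  by rewrite size_cat size_rev !size_drop; lia.
have [odd_t|even_t] := boolP (odd t).
  have even_t1 : ~~ odd (t.+1 %% k).
    have [lt_t1|ge_t1] := ltnP t.+1 k; first by rewrite modn_small //= odd_t.
    by rewrite (_ : t.+1 = k) ?modnn //; lia.
  have bound : ((t.+1 %% k)./2 + t./2).+2 <= k.
    have [lt_t1|ge_t1] := ltnP t.+1 k; first by rewrite modn_small //; lia.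
    by rewrite (_ : t.+1 = k) ?modnn; lia.
  move: B'z; rewrite /z odd_t (negPf even_t1) symB'; apply: win_cut => //; lia.
(* As [k] is even, an even [t] is at most [k - 2]: the walk does not wrap around here, and
   [t = k - 2] gives the costliest cut. *)
have lt_t1 : t.+1 < k by lia.
move: B'z; rewrite /z modn_small //= even_t (negPf even_t); apply: win_cut; lia.
Qed.

(** * The red hub and the merging of paths through it *)

(* The free vertices [ys] of the hub form a red path, disjoint from the blue
   paths [ps]. *)
Definition hub_state (R B : rel nat) (ys : seq nat) ps :=
  [&& sorted R ys, path_system B ps & uniq (ys ++ flatten ps)].

Lemma hub_state_subrel (R R' B B' : rel nat) ys ps :
  subrel R R' -> subrel B B' -> hub_state R B ys ps -> hub_state R' B' ys ps.
Proof.
move=> sR sB /and3P[Rys Bps uniq_ys]; apply/and3P; split=> //.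
  exact: sub_sorted Rys.
exact: (path_system_subrel sB).
Qed.

Lemma hub_state_perm (R B : rel nat) ys ps qs :
  perm_eq ps qs -> hub_state R B ys ps -> hub_state R B ys qs.
Proof.
move=> eq_pq /and3P[Rys Bps uniq_ys]; apply/and3P; split=> //.
  by rewrite -(path_system_perm _ eq_pq).
by rewrite -(perm_uniq (_ : perm_eq (ys ++ flatten ps) _)) // perm_cat2l perm_flatten.
Qed.

Lemma hub_state_head_notin (R B : rel nat) ys p ps :
  hub_state R B ys (p :: ps) -> head 0 p \notin ys.
Proof.
case/and3P=> _ /andP[/andP[/andP[p0 _] _] _]; case: p p0 => //= x p _.
rewrite cat_uniq => /and3P[_ disj _]; apply: contra disj => ys_x.
by apply/hasP; exists x; rewrite ?mem_head.
Qed.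

(** The hub vertex [y] becomes the link between the two paths. Stating its removal by [perm_eq]
    covers both extremities of the hub. *)
Lemma hub_state_join (R B : rel nat) ys zs y p q ps :
    symmetric B -> hub_state R B ys [:: p, q & ps] ->
    perm_eq ys (y :: zs) -> sorted R zs -> B (head 0 p) y -> B (head 0 q) y ->
  hub_state R B zs ((rev p ++ y :: q) :: ps).
Proof.
move=> symB /and3P[_ Bpq uniq_ys] eq_ys Rzs Bpy Bqy.
have {eq_ys}uniq_ys : uniq (y :: zs ++ p ++ q ++ flatten ps).
  by rewrite -(perm_uniq (_ : perm_eq (ys ++ flatten [:: p, q & ps]) _)) // -cat_cons perm_cat2r.
apply/and3P; split=> //; last first.
  rewrite (perm_uniq (_ : perm_eq _ (y :: zs ++ p ++ q ++ flatten ps))) //=.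
  rewrite -catA perm_sym -cat1s perm_catCA perm_cat2l /= -cat1s perm_catCA.
  by rewrite perm_cat ?perm_rev // perm_sym perm_rev.
have swap (a b : seq nat) : perm_eq [:: a, b & ps] [:: b, a & ps].
  by rewrite (perm_catCA [:: a] [:: b]).
have Byqp : path_system B [:: [:: y], q, p & ps].
  have : path_system B [:: q, p & ps] by rewrite (path_system_perm _ (swap q p)).
  case/andP=> /= Bqp uniq_qp; rewrite /path_system /= Bqp uniq_qp andbT.
  move: uniq_ys; rewrite cons_uniq mem_cat negb_or => /andP[/andP[_ notin_y] _].
  by rewrite -(perm_mem (_ : perm_eq (p ++ q ++ flatten ps) _)) // perm_catCA.
rewrite -[_ ++ y :: q]/(rev p ++ rev [:: y] ++ q); apply: path_system_join => //.
rewrite (path_system_perm _ (swap _ _)); apply: path_system_join => //.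
by rewrite symB.
Qed.

(** The vertex [x] only changes sides, so the total is kept; an exhausted path is dropped because a
    path system has no empty path. *)
Lemma hub_state_push (R B : rel nat) ys x p ps :
    hub_state R B ys ((x :: p) :: ps) -> (ys != [::] -> R x (head 0 ys)) ->
  hub_state R B (x :: ys) (if p is [::] then ps else p :: ps).
Proof.
case/and3P=> Rys /andP[/= /andP[Bxp Bps] uniq_xp] uniq_ys Rx; apply/and3P; split.
- by case: ys Rys Rx {uniq_ys} => //= y ys -> ->.
- case: p Bxp uniq_xp {uniq_ys} => [|y p] /=; rewrite /path_system /= Bps.
    by move=> _ /andP[_ ->].
  by case/andP=> _ -> /andP[_ ->].
- have -> : flatten (if p is [::] then ps else p :: ps) = p ++ flatten ps by case: (p).
  by rewrite (perm_uniq (_ : perm_eq _ (ys ++ [:: x] ++ p ++ flatten ps))) //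
             (perm_catCA [:: x] ys).
Qed.

(* Pushing an end on the hub costs at most 2 edges, and joining two paths at most
   5, while it also takes one vertex from the hub: hence the weights 2 and 7. *)
Lemma builder_merges k n j (R B : rel nat) ys ps :
    3 < k -> ~~ odd k -> 0 < n -> symmetric R -> symmetric B ->
    hub_state R B ys ps -> size ys < k ->
    n + 2 * k <= size ys + size (flatten ps) + 3 ->
    2 * (k.-1 - size ys) + 7 * size ps + k <= j ->
  builder_wins (cycle_graph k) (path_graph n) j R B.
Proof.
move=> k_gt3 even_k n_gt0.
elim/ltn_ind: j R B ys ps => j IHj R B ys ps symR symB hub_ys lt_ys le_n le_j.
have Bps : path_system B ps by case/and3P: hub_ys.
(* The hub has at most [k.-1] vertices, so the paths keep at least [n + k - 2]: enough to finish
   with one path, and just what the cycle argument needs with two. *)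
case: ps => [|p [|q [|r ps]]] in hub_ys le_n le_j Bps.
- by move: le_n => /=; lia.
- by apply: (builder_wins_long _ _ _ symB Bps); move: le_n; rewrite /= cats0; lia.
- apply: (builder_wins_leq (m := k)) => //; first by lia.
  by apply: builder_joins_two Bps _ => //; move: le_n; rewrite /= size_cat cats0; lia.
have push i R' B' p' qs : symmetric R' -> symmetric B' ->
    hub_state R' B' ys (p' :: qs) -> perm_eq (p' :: qs) [:: p, q, r & ps] ->
    size ys < k.-1 -> (ys != [::] -> R' (head 0 p') (head 0 ys)) ->
    j <= i + 2 -> i < j ->
    builder_wins (cycle_graph k) (path_graph n) i R' B'.
  move=> symR' symB' hub_p' eq_ps lt_ys1 R'p' le_i lt_i.
  have size_qs := perm_size eq_ps; have := perm_size (perm_flatten eq_ps).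
  have : p' != [::] by case/and3P: hub_p' => _ /andP[/andP[/andP[]]].
  case: p' R'p' hub_p' {eq_ps} size_qs => // x p' R'x hub_x size_qs _ size_f.
  apply: IHj (hub_state_push hub_x R'x) _ _ _ => //=.
  - by lia.
  - by case: (p') size_f => [|x' p'']; move: le_n; rewrite /= ?size_cat; lia.
  - by case: (p') size_f => [|x' p''] /=; move: le_j size_qs => /=; lia.
have join i R' B' zs y p' q' qs : symmetric R' -> symmetric B' ->
    hub_state R' B' ys [:: p', q' & qs] -> perm_eq [:: p', q' & qs] [:: p, q, r & ps] ->
    perm_eq ys (y :: zs) -> sorted R' zs -> B' (head 0 p') y -> B' (head 0 q') y ->
    j <= i + 5 -> i < j ->
    builder_wins (cycle_graph k) (path_graph n) i R' B'.
  move=> symR' symB' hub_p' eq_ps eq_ys R'zs B'p' B'q' le_i lt_i.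
  have size_qs := perm_size eq_ps; have size_f := perm_size (perm_flatten eq_ps).
  have size_ys := perm_size eq_ys.
  apply: IHj (hub_state_join symB' hub_p' eq_ys R'zs B'p' B'q') _ _ _ => //.
  - by move: size_ys => /=; lia.
  - by move: size_f le_n size_ys; rewrite /= !size_cat size_rev /=; lia.
  - by move: size_ys size_qs le_j => /=; lia.
(* An empty hub receives the head of [p] without any edge being played. *)
case: ys => [|y ys] in hub_ys lt_ys le_n le_j push join *.
  have := push j.-2 R B p [:: q, r & ps] symR symB hub_ys (perm_refl _).
  by move=> win; apply: builder_wins_leq (win _ _ _ _) => //=; move: le_j => /=; lia.
have swap (a b : seq nat) qs : perm_eq [:: a, b & qs] [:: b, a & qs].
  by rewrite (perm_catCA [:: a] [:: b]).
have rot_r (a b c : seq nat) : perm_eq [:: a, b, c & ps] [:: c, a, b & ps].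
  by rewrite (perm_catCA [:: a; b] [:: c]).
have rot_q (a b c : seq nat) : perm_eq [:: a, b, c & ps] [:: b, c, a & ps].
  by rewrite (perm_catCA [:: a] [:: b; c]).
have def_j : j = (j - 5).+1.+4 by move: le_j => /=; lia.
move: (j - 5) def_j => i def_j.
have id_sub (E : rel nat) : subrel E E by [].
have play_head p' qs l R' B' z : symmetric R' -> symmetric B' ->
    hub_state R' B' (y :: ys) (p' :: qs) -> z \in y :: ys ->
    (forall R'', symmetric R'' -> subrel R' R'' -> R'' (head 0 p') z ->
       builder_wins (cycle_graph k) (path_graph n) l R'' B') ->
    (forall B'', symmetric B'' -> subrel B' B'' -> B'' (head 0 p') z ->
       builder_wins (cycle_graph k) (path_graph n) l R' B'') ->
    builder_wins (cycle_graph k) (path_graph n) l.+1 R' B'.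
  move=> symR' symB' hub_p' ys_z; apply: builder_play => //.
  by apply: contraNneq (hub_state_head_notin hub_p') => ->.
have joiny l R' B' p' q' qs : symmetric R' -> symmetric B' ->
    hub_state R' B' (y :: ys) [:: p', q' & qs] ->
    perm_eq [:: p', q' & qs] [:: p, q, r & ps] ->
    B' (head 0 p') y -> B' (head 0 q') y -> j <= l + 5 -> l < j ->
    builder_wins (cycle_graph k) (path_graph n) l R' B'.
  move=> symR' symB' hub_p' eq_ps; apply: (join _ _ _ ys y p' q' qs) => //.
  by have /and3P[/path_sorted Rys _ _] := hub_p'.
(* While the hub is not full, two heads suffice: the first one red to [y] is pushed, and two blue
   ones are joined through [y]. *)
have [lt_ys1|ge_ys1] := ltnP (size (y :: ys)) k.-1.
  rewrite def_j; apply: (play_head _ _ _ _ _ y symR symB hub_ys (mem_head _ _)).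
    move=> R1 symR1 sR1 R1py.
    apply: (push _ _ _ p) (hub_state_subrel sR1 _ hub_ys) _ _ _ _ _ => //; clear -def_j; lia.
  move=> B1 symB1 sB1 B1py; have hub1 := hub_state_subrel (@id_sub R) sB1 hub_ys.
  have hub1q := hub_state_perm (swap p q _) hub1.
  apply: (play_head _ _ _ _ _ y symR symB1 hub1q (mem_head _ _)).
    move=> R2 symR2 sR2 R2qy.
    apply: (push _ _ _ q) (hub_state_subrel sR2 _ hub1q) _ _ _ _ _ => //; clear -def_j; lia.
  move=> B2 symB2 sB2 B2qy.
  apply: joiny (hub_state_subrel (@id_sub R) sB2 hub1) _ _ _ _ _ => //; try (clear -def_j; lia).
  exact: sB2.
(* If two heads are red to the first vertex of a full hub, a red edge to its last vertex closes a
   [k]-cycle; two blue ones join the paths there. *)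
have joinz l R' B' p' q' qs : symmetric R' -> symmetric B' ->
    hub_state R' B' (y :: ys) [:: p', q' & qs] ->
    perm_eq [:: p', q' & qs] [:: p, q, r & ps] ->
    R' (head 0 p') y -> R' (head 0 q') y -> j <= l + 5 -> l < j ->
    builder_wins (cycle_graph k) (path_graph n) l.+2 R' B'.
  move=> symR' symB' hub_p' eq_ps R'p' R'q' le_l lt_l.
  have R'ys : sorted R' (y :: ys) by case/and3P: hub_p'.
  have size_ys : (size (y :: ys)).+1 = k by lia.
  have close R'' v : symmetric R'' -> subrel R' R'' -> v \notin y :: ys ->
      R' v y -> R'' v (last y ys) -> has_copy (cycle_graph k) R''.
    move=> symR'' sR' ys_v R'v R''v.
    apply: (has_copy_close (v := v) (s := y :: ys)) => //; last exact: sR'.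
      rewrite /uniq -/uniq ys_v; case/and3P: hub_p' => _ _.
      by rewrite cat_uniq => /and3P[].
    exact: sub_sorted R'ys.
  have hub_q' := hub_state_perm (swap p' q' _) hub_p'.
  apply: (play_head _ _ _ _ _ _ symR' symB' hub_p' (mem_last _ _)).
    move=> R1 symR1 sR1 R1z; apply: builder_wins_over; left.
    by apply: close R1z => //; apply: hub_state_head_notin hub_p'.
  move=> B1 symB1 sB1 B1p'.
  have hub1 := hub_state_subrel (@id_sub R') sB1 hub_q'.
  apply: (play_head _ _ _ _ _ _ symR' symB1 hub1 (mem_last _ _)).
    move=> R1 symR1 sR1 R1z; apply: builder_wins_over; left.
    by apply: close R1z => //; apply: hub_state_head_notin hub1.
  move=> B2 symB2 sB2 B2q'.
  apply: (join _ _ _ (belast y ys) (last y ys) p' q' qs) => //.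
  - by apply: hub_state_subrel hub_p' => // a b /sB1/sB2.
  - by rewrite lastI perm_rcons.
  - by move: R'ys; rewrite lastI -cats1 => /cat_sorted2[].
  - exact: sB2.
(* Among the heads of [p], [q], [r], two get the same color at [y]: blue joins them at [y], red at
   the last hub vertex, after at most 3 + 2 edges. *)
rewrite def_j; apply: (play_head _ _ _ _ _ y symR symB hub_ys (mem_head _ _)).
  move=> R1 symR1 sR1 R1p; have hub1 := hub_state_subrel sR1 (@id_sub B) hub_ys.
  have hub1q := hub_state_perm (swap p q _) hub1.
  apply: (play_head _ _ _ _ _ y symR1 symB hub1q (mem_head _ _)).
    move=> R2 symR2 sR2 R2q; have hub2 := hub_state_subrel sR2 (@id_sub B) hub1.
    by apply: (joinz i.+1 R2 B p q) hub2 _ _ _ _ _ => //; [apply: sR2|clear -def_j; lia..].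
  move=> B2 symB2 sB2 B2q.
  have hub2 := hub_state_subrel (@id_sub R1) sB2 hub1.
  have hub2r := hub_state_perm (rot_r p q r) hub2.
  apply: (play_head _ _ _ _ _ y symR1 symB2 hub2r (mem_head _ _)).
    move=> R3 symR3 sR3 R3r.
    have hub3 := hub_state_subrel sR3 (@id_sub B2) hub2r.
    by apply: (joinz i R3 B2 r p) hub3 _ _ _ _ _ => //; [exact: sR3|clear -def_j; lia..].
  move=> B3 symB3 sB3 B3r.
  have hub3 := hub_state_subrel (@id_sub R1) sB3 (hub_state_perm (rot_q p q r) hub2).
  by apply: (joiny i.+2 R1 B3 q r) hub3 _ _ _ _ _ => //; [exact: sB3|clear -def_j; lia..].
move=> B1 symB1 sB1 B1p; have hub1 := hub_state_subrel (@id_sub R) sB1 hub_ys.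
have hub1q := hub_state_perm (swap p q _) hub1.
apply: (play_head _ _ _ _ _ y symR symB1 hub1q (mem_head _ _)).
  move=> R2 symR2 sR2 R2q; have hub2 := hub_state_subrel sR2 (@id_sub B1) hub1.
  have hub2r := hub_state_perm (rot_r p q r) hub2.
  apply: (play_head _ _ _ _ _ y symR2 symB1 hub2r (mem_head _ _)).
    move=> R3 symR3 sR3 R3r.
    have hub3 := hub_state_subrel sR3 (@id_sub B1) (hub_state_perm (rot_q p q r) hub2).
    by apply: (joinz i R3 B1 q r) hub3 _ _ _ _ _ => //; [exact: sR3|clear -def_j; lia..].
  move=> B3 symB3 sB3 B3r.
  have hub3 := hub_state_subrel (@id_sub R2) sB3 hub2r.
  by apply: (joiny i.+2 R2 B3 r p) hub3 _ _ _ _ _ => //; [exact: sB3|clear -def_j; lia..].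
move=> B2 symB2 sB2 B2q; have hub2 := hub_state_subrel (@id_sub R) sB2 hub1.
by apply: (joiny i.+3 R B2 p q) hub2 _ _ _ _ _ => //; [apply: sB2|clear -def_j; lia..].
Qed.

(** * From the red heads to the hub, and the final count *)

Definition tails (ps : seq (seq nat)) : seq (seq nat) :=
  [seq p <- map behead ps | p != [::]].

Lemma perm_heads_tails (ps : seq (seq nat)) :
    all (fun p => p != [::]) ps ->
  perm_eq (flatten ps) (map (head 0) ps ++ flatten (tails ps)).
Proof.
elim: ps => [|[|x p] ps IHps] //= /IHps eq_ps; rewrite perm_cons.
have -> : flatten (tails ((x :: p) :: ps)) = p ++ flatten (tails ps) by case: p.
by rewrite perm_sym perm_catCA perm_cat2l perm_sym.
Qed.

(** The heads already form a red path, so creating the hub costs no edge. *)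
Lemma hub_state_heads_tails (R B : rel nat) ps :
  red_headed R B ps -> hub_state R B (map (head 0) ps) (tails ps).
Proof.
case/andP=> Rps /andP[Bps uniq_ps].
have ps_neq0 : all (fun p => p != [::]) ps by apply: sub_all Bps => p /andP[].
have uniq_ht : uniq (map (head 0) ps ++ flatten (tails ps)).
  by rewrite -(perm_uniq (perm_heads_tails ps_neq0)).
apply/and3P; split=> //; apply/andP; split; last first.
  by move: uniq_ht; rewrite cat_uniq => /and3P[].
rewrite all_filter all_map; apply: sub_all Bps => -[|x p] //= Bxp.
by apply/implyP=> ->; apply: path_sorted Bxp.
Qed.

Theorem theorem5 (k n : nat) (hk4 : 4 <= k) (hk : ~~ odd k) (hn : 0 < n) :
  exists2 r : nat,
    is_online_ramsey_number (cycle_graph k) (path_graph n) r &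
    r <= 2 * n + 11 * k.
Proof.
(* Starting from the single vertex [0], adding [d] vertices gives [n + 2 * k - 3], the least total
   that merging accepts. *)
apply: ex_least; pose d := n + 2 * k - 4.
have sym0 : symmetric no_edge by [].
(* With [c] paths merging takes at most [2 * (k.-1 - c) + 7 * c + k] edges; its excess over [c] is
   largest at [c = k.-1], where it is [7 * k - 6]. The total is [2 * n + 11 * k - 13]. *)
apply: (builder_wins_leq (m := 2 * d + (7 * k - 6) + size [:: [:: 0]])) => //.
  by rewrite /d /=; lia.
apply: (builder_grows (N := d.+1)) => //; last by rewrite /=; lia.
move=> R B ps symR symB RBps /andP[ps_gt0 lt_ps] size_ps.
have /andP[_ /andP[Bps _]] := RBps.
have ps_neq0 : all (fun p => p != [::]) ps by apply: sub_all Bps => p /andP[].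
have size_ht : d.+1 = size ps + size (flatten (tails ps)).
  by rewrite -size_ps (perm_size (perm_heads_tails ps_neq0)) size_cat size_map.
have le_tails : size (tails ps) <= size ps.
  by rewrite size_filter -(size_map behead ps) count_size.
have le_n : n + 2 * k <= size ps + size (flatten (tails ps)) + 3.
  by move: size_ht; rewrite /d; lia.
have le_j : 2 * (k.-1 - size ps) + 7 * size (tails ps) + k <= 7 * k - 6 + size ps.
  by lia.
by apply: builder_merges (hub_state_heads_tails RBps) _ _ _ => //; rewrite size_map.
Qed.
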